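(* Let $P=(I,J,K)$ be a reduced presentation, so that $\mathcal V(P)$ is a proper subvariety of Wajsberg hoops. Then $\mathcal V(P)$ is structural if and only if either $J=\emptyset$ or $J=\{1\}$.
   Context: Wajsberg hoops: basic hoops satisfying $(x\to y)\to y\approx(y\to x)\to x$. $\Gamma(\mathbf G,u)$ is the Wajsberg hoop on $[0,u]$ with $ab=\max\{a+b-u,0\}$, $a\to b=\min\{u-a+b,u\}$; $\mathbf{\L}_n=\Gamma(\mathbb Z,n)$, $\mathbf{\L}_{n,k}=\Gamma(\mathbb Z\times_l\mathbb Z,(n,k))$ (lexicographic order), $\mathbf{\L}_n^\infty=\mathbf{\L}_{n,0}$, $\mathbf C_\omega$ the negative cone of $\mathbb Z$ (free monoid on one generator). A presentation $P=(I,J,K)$ ($I,J$ finite subsets of $\mathbb N\setminus\{0\}$, $K\subseteq\{\omega\}$) is reduced if $I\cup J\cup K\ne\emptyset$, $J\ne\emptyset\Rightarrow K=\emptyset$, no $m\in I$ divides any element of $(I\setminus\{m\})\cup J$, and no $n\in J$ divides any element of $J\setminus\{n\}$. $\mathcal K_P=\{\mathbf{\L}_i:i\in I\}\cup\{\mathbf{\L}_j^\infty:j\in J\}$ if $K=\emptyset$, and $\{\mathbf{\L}_i:i\in I\}\cup\{\mathbf C_\omega\}$ if $K=\{\omega\}$; $\mathcal V(P)=\mathbf{HSP}(\mathcal K_P)$. The proper subvarieties of Wajsberg hoops are exactly the $\mathcal V(P)$ for reduced $P$. A quasivariety $\mathcal Q$ is structural if for every subquasivariety $\mathcal Q'\subseteq\mathcal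 Q$, $\mathbf H(\mathcal Q')=\mathbf H(\mathcal Q)$ implies $\mathcal Q'=\mathcal Q$. *)

(* Defs.v *)
From HB Require Import structures.
From mathcomp Require Import all_boot all_order all_algebra.
Set Implicit Arguments. Unset Strict Implicit. Unset Printing Implicit Defensive.
Import Order.TTheory GRing.Theory Num.Theory.

Record hoopAlg := HoopAlg {
  hcar :> Type;
  hmul : hcar -> hcar -> hcar;
  himp : hcar -> hcar -> hcar;
  hone : hcar }.

(* Gamma(G,u): the Wajsberg hoop on [0,u] with ab = max{a+b-u,0},       *)
(* a->b = min{u-a+b,u}, for a totally ordered abelian group (G, le).    *)
(* Results are in [0,u]; insubd is only used to type them in [0,u].     *)
Section Gamma.
Local Open Scope ring_scope.
Variables (G : zmodType) (le : rel G) (u : G).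
Definition gmax (a b : G) := if le a b then b else a.
Definition gmin (a b : G) := if le a b then a else b.
Definition in_seg (x : G) : bool := le 0 x && le x u.
Variable (h0 : in_seg 0).
Definition gcar := {x : G | in_seg x}.
Definition gdef : gcar := exist _ 0 h0.
Definition gmul (x y : gcar) : gcar :=
  insubd gdef (gmax (val x + val y - u) 0).
Definition gimp (x y : gcar) : gcar :=
  insubd gdef (gmin (u - val x + val y) u).
Definition gone : gcar := insubd gdef u.
Definition Gamma : hoopAlg := HoopAlg gmul gimp gone.
End Gamma.

Lemma int_in0 (n : nat) : in_seg (fun a b : int => (a <= b)%R) (Posz n) 0.
Proof. by rewrite /in_seg lexx. Qed.
Definition Luk (n : nat) : hoopAlg := @Gamma _ _ _ (int_in0 n).

Definition lexle (x y : int * int) : bool :=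
  ((x.1 < y.1) || ((x.1 == y.1) && (x.2 <= y.2)))%R.

Lemma lex_in0 (n : nat) : in_seg lexle ((Posz n), 0%R) 0%R.
Proof. by rewrite /in_seg /lexle /=; case: n. Qed.
Definition Linf (n : nat) : hoopAlg := @Gamma _ _ _ (lex_in0 n).

Definition ccar := {x : int | (x <= 0)%R}.
Lemma c0 : ((0 : int) <= 0)%R. Proof. by []. Qed.
Definition cdef : ccar := exist _ 0%R c0.
Definition cmul (x y : ccar) : ccar := insubd cdef (val x + val y)%R.
Definition cimp (x y : ccar) : ccar :=
  insubd cdef (if (val y - val x <= 0)%R then (val y - val x)%R else 0%R).
Definition Comega : hoopAlg := HoopAlg cmul cimp cdef.

Definition is_hom (A B : hoopAlg) (f : A -> B) : Prop :=
  [/\ forall x y, f (hmul x y) = hmul (f x) (f y),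
      forall x y, f (himp x y) = himp (f x) (f y) &
      f (hone A) = hone B].

Definition prodAlg (I : Type) (F : I -> hoopAlg) : hoopAlg :=
  @HoopAlg (forall i, F i)
    (fun x y i => hmul (x i) (y i))
    (fun x y i => himp (x i) (y i))
    (fun i => hone (F i)).

Definition hclass := hoopAlg -> Prop.

Definition opH (K : hclass) : hclass := fun A =>
  exists B, K B /\ exists f : B -> A, is_hom f /\ (forall a, exists b, f b = a).
Definition opS (K : hclass) : hclass := fun A =>
  exists B, K B /\ exists f : A -> B, is_hom f /\ injective f.
Definition opP (K : hclass) : hclass := fun A =>
  exists (I : Type) (F : I -> hoopAlg), (forall i, K (F i)) /\
    exists f : A -> prodAlg F, is_hom f /\ bijective f.

Inductive term : Type :=
  | tvar of nat | tone | tmul of term & term | timp of term & term.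

Fixpoint teval (A : hoopAlg) (v : nat -> A) (t : term) : A :=
  match t with
  | tvar n => v n
  | tone => hone A
  | tmul s t => hmul (teval v s) (teval v t)
  | timp s t => himp (teval v s) (teval v t)
  end.

Definition quasi_id := (seq (term * term) * (term * term))%type.

Definition sat_qid (A : hoopAlg) (q : quasi_id) : Prop :=
  forall v : nat -> A,
    foldr (fun e P => teval v e.1 = teval v e.2 /\ P) True q.1 ->
    teval v q.2.1 = teval v q.2.2.

Definition quasivariety (Q : hclass) : Prop :=
  exists Sigma : quasi_id -> Prop,
    forall A, Q A <-> (forall q, Sigma q -> sat_qid A q).

Definition subclass (Q1 Q2 : hclass) : Prop := forall A, Q1 A -> Q2 A.
Definition same_class (Q1 Q2 : hclass) : Prop := forall A, Q1 A <-> Q2 A.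

Definition structural (Q : hclass) : Prop :=
  forall Q' : hclass, quasivariety Q' -> subclass Q' Q ->
    same_class (opH Q') (opH Q) -> same_class Q' Q.

(* Presentations P = (I, J, K); K = true encodes K = {omega}.          *)
Definition reduced (I J : seq nat) (K : bool) : Prop :=
  [/\ all (fun i => 0 < i)%N I /\ all (fun j => 0 < j)%N J,
      (I != [::]) || (J != [::]) || K,
      (J != [::]) ==> ~~ K,
      (forall m, m \in I -> forall x,
          ((x \in I) && (x != m)) || (x \in J) -> ~~ (m %| x)%N) &
      (forall n, n \in J -> forall x,
          (x \in J) && (x != n) -> ~~ (n %| x)%N)].

Definition KP (I J : seq nat) (K : bool) : hclass := fun A =>
  (exists2 i, i \in I & A = Luk i) \/
  (~~ K /\ exists2 j, j \in J & A = Linf j) \/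
  (K /\ A = Comega).

Definition VP (I J : seq nat) (K : bool) : hclass := opH (opS (opP (KP I J K))).

(* Main.v *)
(* If every element of J is 1, then V(P) is generated by K_P as a quasivariety:
   when a quasi-identity "p = 1 implies c = 1" holds in a generator, so does the
   identity p^N -> c = 1 for some N. For C_omega and L_1^infty this follows from
   Dickson's lemma, since term functions are piecewise linear and homogeneous.
   Moreover, each generator embeds in every algebra of V(P) that maps onto it: a
   suitable term sends any preimage of a generating element to an element that,
   in every coordinate, generates the image of the generator or is trivial.

   If J contains some n > 1, the quasi-identity "if x is the coatom of a copy of
   L_n and y is infinitesimally close to 1, then y = 1" fails in L_n^infty. It
   holds in the other generators and in the subalgebra of L_n^infty on the pairs
   (a,b) with n | b - a. This subalgebra satisfies the same identities as
   L_n^infty, so the quasi-identity cuts out a proper subquasivariety that still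
   generates V(P) by homomorphic images. *)

Require Import Defs.
From mathcomp Require Import all_boot all_order all_algebra.
From mathcomp Require Import zify.
From Stdlib Require Import ClassicalEpsilon FunctionalExtensionality ProofIrrelevance.
Set Implicit Arguments. Unset Strict Implicit. Unset Printing Implicit Defensive.
Import Order.TTheory GRing.Theory Num.Theory.

(** * Terms, homomorphisms and the preservation of identities and quasi-identities *)

Definition hpow (A : hoopAlg) (x : A) (k : nat) : A := iter k (hmul x) (hone A).

Definition tpow (t : term) (k : nat) : term := iter k (tmul t) tone.

Lemma teval_tpow (A : hoopAlg) (v : nat -> A) t k :
  teval v (tpow t k) = hpow (teval v t) k.
Proof. by elim: k => //= k ->. Qed.

Lemma eq_teval (A : hoopAlg) (v w : nat -> A) t :
  v =1 w -> teval v t = teval w t.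
Proof. by move=> e; elim: t => //= s -> t ->. Qed.

Lemma teval_hom (A B : hoopAlg) (f : A -> B) (v : nat -> A) t :
  is_hom f -> teval (f \o v) t = f (teval v t).
Proof.
by case=> hm hi h1; elim: t => //= s -> t ->; rewrite ?hm ?hi.
Qed.

Lemma hom_hpow (A B : hoopAlg) (f : A -> B) x k :
  is_hom f -> f (hpow x k) = hpow (f x) k.
Proof. by case=> hm _ h1; elim: k => //= k <-. Qed.

Definition valid_eq (A : hoopAlg) (s t : term) : Prop :=
  forall v : nat -> A, teval v s = teval v t.

Definition valid_in (K : hclass) (s t : term) : Prop :=
  forall A, K A -> valid_eq A s t.

Lemma lift_valuation (A B : hoopAlg) (f : B -> A) (v : nat -> A) :
  (forall a, exists b, f b = a) -> exists w : nat -> B, f \o w =1 v.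
Proof.
move=> sf; exists (fun n => sval (constructive_indefinite_description _ (sf (v n)))).
by move=> n /=; case: constructive_indefinite_description.
Qed.

Lemma valid_opH (K : hclass) s t : valid_in K s t -> valid_in (opH K) s t.
Proof.
move=> h A [B [KB [f [fh fs]]]] v; have [w e] := lift_valuation v fs.
by rewrite -!(eq_teval _ e) !teval_hom // (h B).
Qed.

Definition prems (A : hoopAlg) (v : nat -> A) (l : seq (term * term)) : Prop :=
  foldr (fun e P => teval v e.1 = teval v e.2 /\ P) True l.

Lemma prems_hom (A B : hoopAlg) (f : A -> B) (v : nat -> A) l :
  is_hom f -> prems v l -> prems (f \o v) l.
Proof.
by move=> fh; elim: l => //= -[a b] l IH /= [e /IH ?]; rewrite !teval_hom // e.
Qed.

Lemma sat_qid_embed (A B : hoopAlg) (f : A -> B) q :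
  is_hom f -> injective f -> sat_qid B q -> sat_qid A q.
Proof.
move=> fh fi h v /(prems_hom fh) /h; rewrite !teval_hom //; exact: fi.
Qed.

Lemma proj_hom (I : Type) (F : I -> hoopAlg) i :
  @is_hom (prodAlg F) (F i) (fun x => x i).
Proof. by []. Qed.

Lemma sat_qid_opSP (K : hclass) q :
  (forall A, K A -> sat_qid A q) -> forall A, opS (opP K) A -> sat_qid A q.
Proof.
move=> h A [B [[I [F [KF [g [gh /bij_inj gi]]]]] [f [fh fi]]]].
apply: (sat_qid_embed fh fi); apply: (sat_qid_embed gh gi) => v hv.
apply: functional_extensionality_dep => i.
have ph := proj_hom F i; move: (h _ (KF i) _ (prems_hom ph hv)).
by rewrite !(teval_hom _ _ ph).
Qed.

Lemma valid_HSP (K : hclass) s t :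
  valid_in K s t -> valid_in (opH (opS (opP K))) s t.
Proof.
move=> h; apply: valid_opH => A hA v.
have hq B : K B -> sat_qid B ([::], (s, t)) by move=> /h hB w _; exact: hB.
exact: (sat_qid_opSP hq hA).
Qed.

Lemma opH_opH (K : hclass) A : opH (opH K) A -> opH K A.
Proof.
case=> B [[C [KC [g [[gm gi g1] gs]]]] [f [[fm fi f1] fs]]].
exists C; split=> //; exists (f \o g); split.
  by split=> [x y|x y|] /=; rewrite ?gm ?gi ?g1 ?fm ?fi ?f1.
by move=> a; have [b <-] := fs a; have [c <-] := gs b; exists c.
Qed.

Lemma sub_HSP (K : hclass) A : K A -> opH (opS (opP K)) A.
Proof.
move=> KA; have idh (B : hoopAlg) : is_hom (@id B) by [].
exists A; split; last by exists id; split=> // a; exists a.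
exists (prodAlg (fun _ : unit => A)); split.
  exists unit, (fun=> A); split=> //; exists id; split=> //; by exists id.
exists (fun a _ => a); split=> // a b /(congr1 (fun f => f tt)) //.
Qed.

(** * Birkhoff's theorem *)

Section Birkhoff.

Fixpoint tren (r : nat -> nat) (t : term) : term :=
  match t with
  | tvar n => tvar (r n)
  | tone => tone
  | tmul s t => tmul (tren r s) (tren r t)
  | timp s t => timp (tren r s) (tren r t)
  end.

Lemma teval_tren (A : hoopAlg) (v : nat -> A) r t :
  teval v (tren r t) = teval (v \o r) t.
Proof. by elim: t => //= s -> t ->. Qed.

Definition interleave (T : Type) (s s' : nat -> T) (n : nat) : T :=
  if odd n then s' n./2 else s n./2.

Lemma interleave_even (T : Type) (s s' : nat -> T) :
  interleave s s' \o double =1 s.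
Proof. by move=> n; rewrite /interleave /= odd_double doubleK. Qed.

Lemma interleave_odd (T : Type) (s s' : nat -> T) :
  interleave s s' \o (fun n => n.*2.+1) =1 s'.
Proof. by move=> n; rewrite /interleave /= odd_double /= uphalf_double. Qed.

Variables (T : Type) (G : T -> hoopAlg) (A : hoopAlg).
Hypothesis idA : forall s t, (forall c, valid_eq (G c) s t) -> valid_eq A s t.

(** With one coordinate for every map from [A] to a generator, the words in the coordinate functions
    form the free algebra over the set [A]. *)
Let idx := {c : T & A -> G c}.
Let PG := prodAlg (fun i : idx => G (projT1 i)).

(* The element of the free algebra represented by [t] with its variable [n]
   standing for the generator [s n]. *)
Definition word (t : term) (s : nat -> A) : PG :=
  fun i => teval (projT2 i \o s) t.

Definition is_word (x : PG) : Prop :=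
  exists ts : term * (nat -> A), x = word ts.1 ts.2.

(** The even variables go to [s] and the odd ones to [s'], so that operations on words and
    comparisons of words only concern a common assignment. *)
Lemma merge_words t s t' s' : exists r r' s'',
  [/\ word t s = word (tren r t) s'', word t' s' = word (tren r' t') s'',
      teval s t = teval s'' (tren r t) & teval s' t' = teval s'' (tren r' t')].
Proof.
exists double, (fun n => n.*2.+1), (interleave s s'); split; last 2 first.
- by rewrite teval_tren; apply/esym/eq_teval/interleave_even.
- by rewrite teval_tren; apply/esym/eq_teval/interleave_odd.
- apply: functional_extensionality_dep => i; rewrite /word teval_tren.
  by apply: eq_teval => n /=; congr (projT2 i _); rewrite -[LHS](interleave_even s s').
- apply: functional_extensionality_dep => i; rewrite /word teval_tren.
  by apply: eq_teval => n /=; congr (projT2 i _); rewrite -[LHS](interleave_odd s s').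
Qed.

(* Variables with the same image under [s] have to be identified before the
   identities of the generators can be applied. *)
Lemma word_inj_common t t' s : word t s = word t' s -> teval s t = teval s t'.
Proof.
move=> e; pose rho a := epsilon (inhabits 0) (fun m => s m = a).
have rhoP n : s (rho (s n)) = s n.
  exact: (epsilon_spec (inhabits 0) (fun m => s m = s n) (ex_intro _ n erefl)).
have := @idA (tren (rho \o s) t) (tren (rho \o s) t') _ s.
rewrite !teval_tren !(eq_teval (v := s \o (rho \o s)) (w := s)) //; apply.
move=> c w; rewrite !teval_tren.
by have := congr1 (fun x : PG => x (existT _ c (w \o rho))) e.
Qed.

Lemma word_inj t s t' s' : word t s = word t' s' -> teval s t = teval s' t'.
Proof.
have [r [r' [s'' [-> -> -> ->]]]] := merge_words t s t' s'.
exact: word_inj_common.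
Qed.

Lemma is_word_op (op : forall B : hoopAlg, B -> B -> B) (top : term -> term -> term) :
  (forall (B : hoopAlg) (v : nat -> B) s t, teval v (top s t) = op B (teval v s) (teval v t)) ->
  (forall x y : PG, op PG x y = fun i => op _ (x i) (y i)) ->
  forall x y : PG, is_word x -> is_word y -> is_word (op PG x y).
Proof.
move=> ev opE x y [[t s] /= ->] [[t' s'] /= ->].
have [r [r' [s'' [-> -> _ _]]]] := merge_words t s t' s'.
exists (top (tren r t) (tren r' t'), s''); rewrite opE /word /=.
by apply: functional_extensionality_dep => i; rewrite ev.
Qed.

Lemma is_word_mul (x y : PG) : is_word x -> is_word y -> is_word (hmul x y).
Proof. exact: (@is_word_op (@hmul) tmul). Qed.

Lemma is_word_imp (x y : PG) : is_word x -> is_word y -> is_word (himp x y).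
Proof. exact: (@is_word_op (@himp) timp). Qed.

Lemma is_word_one : is_word (hone PG).
Proof. by exists (tone, fun=> hone A). Qed.

Definition freeAlg : hoopAlg := @HoopAlg {x : PG | is_word x}
  (fun x y => exist _ _ (is_word_mul (svalP x) (svalP y)))
  (fun x y => exist _ _ (is_word_imp (svalP x) (svalP y)))
  (exist _ _ is_word_one).

Definition free_eval (x : freeAlg) : A :=
  let ts := sval (constructive_indefinite_description _ (svalP x)) in
  teval ts.2 ts.1.

Lemma free_evalE (x : freeAlg) t s : sval x = word t s -> free_eval x = teval s t.
Proof.
move=> e; rewrite /free_eval; case: constructive_indefinite_description => -[t' s'] /= e'.
by apply: word_inj; rewrite -e -e'.
Qed.

Lemma free_eval_hom : is_hom free_eval.
Proof.
split=> [x y|x y|]; last by rewrite (@free_evalE _ tone (fun=> hone A)).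
- have [[[t s] /= ex] [[t' s'] /= ey]] := (svalP x, svalP y).
  rewrite (free_evalE ex) (free_evalE ey); have := merge_words t s t' s'.
  case=> r [r' [s'' [e e' -> ->]]].
  rewrite (@free_evalE _ (tmul (tren r t) (tren r' t')) s'') //=.
  by rewrite ex ey e e'.
- have [[[t s] /= ex] [[t' s'] /= ey]] := (svalP x, svalP y).
  rewrite (free_evalE ex) (free_evalE ey); have := merge_words t s t' s'.
  case=> r [r' [s'' [e e' -> ->]]].
  rewrite (@free_evalE _ (timp (tren r t) (tren r' t')) s'') //=.
  by rewrite ex ey e e'.
Qed.

(** [A] is the image under [free_eval] of the free algebra over its own elements, which is a
    subalgebra of [PG]. *)
Theorem birkhoff : opH (opS (opP (fun B => exists c, B = G c))) A.
Proof.
exists freeAlg; split; last first.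
  exists free_eval; split; first exact: free_eval_hom.
  move=> a; have wa : is_word (word (tvar 0) (fun=> a)).
    by exists (tvar 0, fun=> a).
  by exists (exist _ _ wa); rewrite (@free_evalE _ (tvar 0) (fun=> a)).
exists PG; split.
  exists idx, (fun i => G (projT1 i)); split; first by move=> i; exists (projT1 i).
  by exists id; split=> //; exists id.
exists sval; split=> // -[x hx] [y hy] /= e.
by case: _ / e hy => hy; rewrite (proof_irrelevance _ hx hy).
Qed.

End Birkhoff.

(** * The generators in dual coordinates *)

(* An element [x] of [0,u] is represented by [u - x]: the unit becomes 0, the
   product truncated addition, and [x -> y] the truncated difference. *)
Definition Ldual (n : nat) : hoopAlg :=
  HoopAlg (fun x y : nat => minn n (x + y)) (fun x y => y - x) 0.

Definition Cdual : hoopAlg := HoopAlg (fun x y : nat => x + y) (fun x y => y - x) 0.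

(* [(true, k)] stands for (1, -k) and [(false, k)] for (0, k). *)
Definition Chang : hoopAlg :=
  @HoopAlg (bool * nat)%type
    (fun x y => match x, y with
       | (true, a), (true, b) => (true, a + b)
       | (true, a), (false, b) => (false, b - a)
       | (false, a), (true, b) => (false, a - b)
       | (false, _), (false, _) => (false, 0)
       end)
    (fun x y => match x, y with
       | (true, a), (true, b) => (true, b - a)
       | (true, a), (false, b) => (false, a + b)
       | (false, a), (true, b) => (true, 0)
       | (false, a), (false, b) => (true, a - b)
       end)
    (true, 0).

Definition Lexdual (n : nat) : hoopAlg :=
  HoopAlg (fun x y : int * int =>
             gmin lexle (x.1 + y.1, x.2 + y.2)%R (Posz n, 0%R))
          (fun x y => gmax lexle (y.1 - x.1, y.2 - x.2)%R (0%R, 0%R))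
          (0%R, 0%R).

Definition dL (n : nat) (x : Luk n) : Ldual n := `|(Posz n - val x)%R|%N.
Definition dC (x : Comega) : Cdual := `|val x|%N.
Definition dChang (x : Linf 1) : Chang :=
  ((val x).1 == 1%R, `|(val x).2|%N).
Definition dX (n : nat) (x : Linf n) : Lexdual n :=
  (Posz n - (val x).1, - (val x).2)%R.

Lemma dL_hom n : is_hom (@dL n).
Proof.
split=> [[x hx] [y hy]|[x hx] [y hy]|]; rewrite /dL /=.
- rewrite insubdK /gmax /in_seg /= ?/(_ \in _) /=; move: hx hy; rewrite /in_seg /=;
  case: ifP; lia.
- rewrite insubdK /gmin /in_seg /= ?/(_ \in _) /=; move: hx hy; rewrite /in_seg /=;
  case: ifP; lia.
- by rewrite insubdK /gmin /in_seg /= ?/(_ \in _) /=; lia.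
Qed.

Lemma dL_inj n : injective (@dL n).
Proof.
move=> [x hx] [y hy] /= e; apply: val_inj => /=.
by move: e; rewrite /dL /= => e; move: hx hy e; rewrite /in_seg; lia.
Qed.

Lemma dL_le n (x : Luk n) : dL x <= n.
Proof. by case: x => x; rewrite /in_seg /dL /=; lia. Qed.

Lemma dL_surj n z : z <= n -> exists x : Luk n, dL x = z.
Proof.
move=> h; have hx : in_seg (fun a b : int => (a <= b)%R) (Posz n) (Posz n - Posz z)%R.
  by rewrite /in_seg; lia.
by exists (exist (in_seg _ _) _ hx); rewrite /dL /=; lia.
Qed.

Lemma dC_hom : is_hom dC.
Proof.
split=> [[x hx] [y hy]|[x hx] [y hy]|]; rewrite /dC //=.
- by rewrite insubdK ?/(_ \in _) /=; lia.
- by rewrite insubdK ?/(_ \in _) /=; case: ifP; lia.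
Qed.

Lemma dC_inj : injective dC.
Proof.
by move=> [x hx] [y hy] /= e; apply: val_inj => /=; move: e; rewrite /dC /=; lia.
Qed.

Lemma dC_surj z : exists x : Comega, dC x = z.
Proof.
have hx : (- Posz z <= 0)%R by lia.
by exists (exist (fun x : int => x <= 0)%R _ hx); rewrite /dC /=; lia.
Qed.

Lemma dX_hom n : is_hom (@dX n).
Proof.
split=> [[[x x'] hx] [[y y'] hy]|[[x x'] hx] [[y y'] hy]|]; rewrite /dX /=.
- rewrite insubdK /gmax /gmin /lexle /= ?/(_ \in _) /=; move: hx hy;
    rewrite /in_seg /lexle /=; do ?case: ifP => ? /=; try lia;
    by move=> ? ?; congr pair; lia.
- rewrite insubdK /gmax /gmin /lexle /= ?/(_ \in _) /=; move: hx hy;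
    rewrite /in_seg /lexle /=; do ?case: ifP => ? /=; try lia;
    by move=> ? ?; congr pair; lia.
- by rewrite insubdK /= ?/(_ \in _) /in_seg /lexle /= ?subrr ?oppr0 //; lia.
Qed.

Lemma dX_inj n : injective (@dX n).
Proof.
move=> [[x x'] hx] [[y y'] hy] /= [] e e'; apply: val_inj => /=.
by congr pair; lia.
Qed.

Definition lexseg (n : nat) (z : int * int) : Prop :=
  (lexle (0, 0) z && lexle z (Posz n, 0))%R.

Lemma dX_seg n (x : Linf n) : lexseg n (dX x).
Proof.
case: x => [[x x']]; rewrite /lexseg /in_seg /dX /lexle /=.
lia.
Qed.

Lemma dX_surj n z : lexseg n z -> exists x : Linf n, dX x = z.
Proof.
case: z => a b h.
have hx : in_seg lexle (Posz n, 0%R) (Posz n - a, - b)%R.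
  by move: h; rewrite /lexseg /in_seg /lexle /=; lia.
by exists (exist (in_seg _ _) _ hx); rewrite /dX /=; congr pair; lia.
Qed.

Lemma lexseg1 (x : int) x' : in_seg lexle (Posz 1, 0%R) (x, x') ->
  (x = 0 /\ 0 <= x' \/ x = 1 /\ x' <= 0)%R.
Proof. by rewrite /in_seg /lexle /=; lia. Qed.

Lemma dChang_hom : is_hom dChang.
Proof.
split=> [[[x x'] hx] [[y y'] hy]|[[x x'] hx] [[y y'] hy]|]; rewrite /dChang /=.
- rewrite insubdK /gmax /lexle /= ?/(_ \in _) /=;
  case: (lexseg1 hx) => -[ex bx]; case: (lexseg1 hy) => -[ey by_]; subst x y => /=;
    rewrite /in_seg /lexle /=; do ?[case: ifP => h /=]; try lia; congr pair; lia.
- rewrite insubdK /gmin /lexle /= ?/(_ \in _) /=;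
  case: (lexseg1 hx) => -[ex bx]; case: (lexseg1 hy) => -[ey by_]; subst x y => /=;
    rewrite /in_seg /lexle /=; do ?[case: ifP => h /=]; try lia; congr pair; lia.
- by rewrite insubdK.
Qed.

Lemma dChang_inj : injective dChang.
Proof.
move=> [[x x'] hx] [[y y'] hy] /= [] e e'; apply: val_inj => /=.
by move: hx hy; rewrite /in_seg /lexle /= => hx hy; congr pair; lia.
Qed.

Lemma dChang_surj z : exists x : Linf 1, dChang x = z.
Proof.
case: z => -[] k.
- have hx : in_seg lexle (Posz 1, 0%R) (1, - Posz k)%R.
    by rewrite /in_seg /lexle /=; lia.
  by exists (exist (in_seg _ _) _ hx); rewrite /dChang /=; congr pair; lia.
- have hx : in_seg lexle (Posz 1, 0%R) (0, Posz k)%R.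
    by rewrite /in_seg /lexle /=; lia.
  by exists (exist (in_seg _ _) _ hx); rewrite /dChang /=; congr pair; lia.
Qed.

Lemma hpow_Ldual n (x : Ldual n) k : hpow x k = minn n (k * x) :> nat.
Proof. by elim: k => [|k IH] /=; rewrite ?IH; nia. Qed.

Lemma hpow_Cdual (x : Cdual) k : hpow x k = k * x :> nat.
Proof. by elim: k => [|k IH] //=; rewrite IH mulSn. Qed.

Lemma hpow_Chang_true a k : hpow ((true, a) : Chang) k = (true, k * a).
Proof. by elim: k => [|k IH] //=; rewrite IH mulSn. Qed.

Lemma hpow_Chang_false a k : 1 < k -> hpow ((false, a) : Chang) k = (false, 0).
Proof.
case: k => [|[|k]] // _; by elim: k => // k; rewrite /hpow !iterS => ->.
Qed.

(** * Local deduction with a uniform exponent *)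

Lemma exists_minimum (X : Type) (P : X -> Prop) (m : X -> nat) :
  (exists x, P x) -> exists x, P x /\ forall y, P y -> m x <= m y.
Proof.
case=> x; have [k] := ubnP (m x); elim: k x => // k IH x lek Px.
have [[y [Py ly]]|none] := classic (exists y, P y /\ m y < m x).
  by apply: (IH y) => //; exact: leq_trans ly _.
exists x; split=> // y Py; rewrite leqNgt; apply/negP => ly.
by apply: none; exists y.
Qed.

(** Well-quasi-ordering in its infinite form: a whole subsequence is extracted, rather than one
    related pair, so that conjunctions are handled by extracting twice. On tuples of naturals this
    gives Dickson's lemma. *)
Definition ramsey_rel (X : Type) (R : X -> X -> Prop) : Prop :=
  forall u : nat -> X, exists f : nat -> nat,
    (forall i j, i < j -> f i < f j) /\
    (forall i j, i < j -> R (u (f i)) (u (f j))).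

Lemma ramsey_leq (X : Type) (m : X -> nat) : ramsey_rel (fun x y => m x <= m y).
Proof.
move=> u.
have next N : exists k, N <= k /\ forall j, N <= j -> m (u k) <= m (u j).
  by apply: (@exists_minimum nat (fun k => N <= k) (m \o u)); exists N.
(* [g N] is an index minimizing [m] on the tail from [N]; iterating it yields a subsequence along
   which [m] never decreases. *)
pose g N := sval (constructive_indefinite_description _ (next N)).
have gP N : N <= g N /\ forall j, N <= j -> m (u (g N)) <= m (u j).
  by rewrite /g; case: constructive_indefinite_description.
pose f := nat_rect (fun=> nat) (g 0) (fun _ x => g x.+1).
have fS i : f i < f i.+1 by case: (gP (f i).+1).
have fle i : exists2 N, f i = g N & N <= f i.
  by case: i => [|i]; [exists 0 | exists (f i).+1] => //; case: (gP (f i).+1).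
have flt i j : i < j -> f i < f j.
  by apply: (homo_ltn (r := fun a b => a < b)) => // a b c; apply: ltn_trans.
exists f; split=> // i j /flt lt; have [N e le] := fle i.
by rewrite e; apply: (gP N).2; apply: leq_trans (ltnW lt).
Qed.

Lemma ramsey_and (X : Type) (R S : X -> X -> Prop) :
  ramsey_rel R -> ramsey_rel S -> ramsey_rel (fun x y => R x y /\ S x y).
Proof.
move=> hR hS u; have [f [fi fR]] := hR u; have [g [gi gS]] := hS (u \o f).
exists (f \o g); split=> [i j /gi /fi //|i j lt]; split; last exact: gS.
by apply: fR; exact: gi.
Qed.

Lemma ramsey_sub (X : Type) (R S : X -> X -> Prop) :
  (forall x y, R x y -> S x y) -> ramsey_rel R -> ramsey_rel S.
Proof.
by move=> h hR u; have [f [fi fR]] := hR u; exists f; split=> // i j /fR /h.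
Qed.

(* If [trace_le t v w], the value of [t] is linear along [v, w], because every
   difference that gets truncated keeps its sign. *)
Fixpoint trace_le (t : term) (v w : nat -> Chang) : Prop :=
  match t with
  | tvar n => (v n).1 = (w n).1 /\ (v n).2 <= (w n).2
  | tone => True
  | tmul s t | timp s t =>
    (trace_le s v w /\ trace_le t v w) /\
    ((teval v s).2 - (teval v t).2 <= (teval w s).2 - (teval w t).2 /\
     (teval v t).2 - (teval v s).2 <= (teval w t).2 - (teval w s).2)
  end.

Lemma ramsey_trace t : ramsey_rel (trace_le t).
Proof.
elim: t => [n||s hs t ht|s hs t ht] /=; last 2 first.
- do 2!apply: ramsey_and => //.
    exact: (ramsey_leq (fun v : nat -> Chang => (teval v s).2 - (teval v t).2)).
  exact: (ramsey_leq (fun v : nat -> Chang => (teval v t).2 - (teval v s).2)).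
- do 2!apply: ramsey_and => //.
    exact: (ramsey_leq (fun v : nat -> Chang => (teval v s).2 - (teval v t).2)).
  exact: (ramsey_leq (fun v : nat -> Chang => (teval v t).2 - (teval v s).2)).
- apply: ramsey_and; last exact: (ramsey_leq (fun v : nat -> Chang => (v n).2)).
  (* Monotonicity of a boolean together with that of its negation forces equality. *)
  have := ramsey_and (ramsey_leq (fun v : nat -> Chang => nat_of_bool (v n).1))
    (ramsey_leq (fun v : nat -> Chang => nat_of_bool (~~ (v n).1))).
  by apply: ramsey_sub => v w; case: (v n).1; case: (w n).1 => -[].
- by move=> u; exists id.
Qed.

Definition vdiff (v w : nat -> Chang) : nat -> Chang :=
  fun n => ((w n).1, (w n).2 - (v n).2).

Lemma teval_vdiff t v w : trace_le t v w ->
  [/\ (teval v t).1 = (teval w t).1, (teval v t).2 <= (teval w t).2 &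
      teval (vdiff v w) t = ((teval w t).1, (teval w t).2 - (teval v t).2)].
Proof.
elim: t => [n||s hs t ht|s hs t ht] //=; first by case.
- case=> -[/hs [es ls ->]] /ht [et lt ->]; move: es ls et lt.
  case: (teval v s) (teval v t) (teval w s) (teval w t) => [[] a] [[] b] [[] c] [[] d] //=;
  by move=> _ ? _ ? [? ?]; split=> //; try congr pair; lia.
- case=> -[/hs [es ls ->]] /ht [et lt ->]; move: es ls et lt.
  case: (teval v s) (teval v t) (teval w s) (teval w t) => [[] a] [[] b] [[] c] [[] d] //=;
  by move=> _ ? _ ? [? ?]; split=> //; try congr pair; lia.
Qed.

Lemma trace_le_refl t v : trace_le t v v.
Proof. by elim: t. Qed.

Definition detachment (G : hoopAlg) (p c : term) : Prop :=
  forall v : nat -> G, teval v p = hone G -> teval v c = hone G.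

(** Where [p] is not 1, its [N]-th power is the least element, since [N] is at least [n]; where [p]
    is 1, so is [c]. *)
Lemma Luk_deduction n p c N : detachment (Luk n) p c -> n <= N ->
  valid_eq (Luk n) (timp (tpow p N) c) tone.
Proof.
move=> h le v; apply: dL_inj; have dh := dL_hom n.
rewrite -!(teval_hom _ _ dh) /= teval_tpow hpow_Ldual.
have := h v; have := dL_le (teval v c); rewrite !(teval_hom _ _ dh).
have [ep|ep] := eqVneq (dL (teval v p) : nat) 0.
  move=> _ ->; first by case: dh => _ _ ->; rewrite /=; lia.
  by apply: dL_inj; case: dh => _ _ ->.
move=> le' _; rewrite /=; move: ep le'; generalize (dL (teval v p)) (dL (teval v c)).
move=> /= a b; nia.
Qed.

Section ChangDeduction.

(** Covers L_1^infty, whose image is all of Chang's algebra, and C_omega, whose image is the set of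
    the (1, -k). Both images allow any change of the second coordinate, hence are closed under
    [vdiff]. *)
Variables (G : hoopAlg) (h : G -> Chang).
Hypotheses (hh : is_hom h) (hi : injective h)
  (h_surj : forall g k, exists g', h g' = ((h g).1, k)).

Definition in_range (v : nat -> Chang) : Prop := exists w : nat -> G, v = h \o w.

Lemma in_range_vdiff v w : in_range w -> in_range (vdiff v w).
Proof.
move=> [w' ->].
exists (fun n => sval (constructive_indefinite_description _
   (h_surj (w' n) ((h (w' n)).2 - (v n).2)))).
apply: functional_extensionality => n /=.
by case: constructive_indefinite_description.
Qed.

Variables p c : term.
Hypothesis pc : detachment G p c.

Lemma in_range_detachment v : in_range v ->
  teval v p = (true, 0) -> teval v c = (true, 0).
Proof.
have h1 : h (hone G) = (true, 0) by case: hh => _ _ ->.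
by move=> [w ->]; rewrite !teval_hom // -h1 => /hi /pc ->.
Qed.

Definition violates (N : nat) (v : nat -> Chang) : Prop :=
  [/\ in_range v, (teval v p).1, (teval v c).1 & N * (teval v p).2 < (teval v c).2].

(* [vdiff v v] has the first coordinates of [v] and zero second coordinates. *)
Lemma violates_of_neq N v : 1 < N -> in_range v ->
  teval v (timp (tpow p N) c) <> (true, 0) -> violates N v.
Proof.
move=> N1 vr; rewrite /= teval_tpow.
have [] := And3 (teval_vdiff (trace_le_refl p v)) (teval_vdiff (trace_le_refl c v))
  (in_range_detachment (in_range_vdiff v vr)).
move=> [_ _ ->] [_ _ ->]; rewrite /violates !subnn.
case: (teval v p) (teval v c) => [[] a] [[] b] /=.
- rewrite hpow_Chang_true => _ ne; split=> //; rewrite ltnNge; apply/negP => le.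
  by apply: ne; congr pair; lia.
- by move=> /(_ erefl).
- by rewrite hpow_Chang_false.
- by rewrite hpow_Chang_false // sub0n.
Qed.

(* Take for each [N] a counterexample minimizing the value of [c]. For two of
   them, [x] and [y], with [trace_le p x y] and [trace_le c x y], the difference
   is no counterexample for the exponent [N] of [y], so [x] is one for [N];
   as [N] is arbitrarily large, the value of [p] at [x] is the unit while that of
   [c] is not. *)
Lemma Chang_deduction : exists N0, forall N, N0 <= N ->
  valid_eq G (timp (tpow p N) c) tone.
Proof.
apply: NNPP => none.
have viol N0 : exists v, violates N0 v.
  (* From the exponent 2 on, the powers of every (0, k) are the least element. *)
  apply: NNPP => nv; apply: none; exists (maxn N0 2) => N le v.
  apply: hi; rewrite -!(teval_hom _ _ hh); apply: NNPP => ne; apply: nv.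
  exists (h \o v); have : violates N (h \o v).
    by apply: violates_of_neq => //; [lia | exists v].
  by case=> *; split=> //; nia.
have minv N : exists v, violates N v /\
    forall w, violates N w -> (teval v c).2 <= (teval w c).2.
  exact: (@exists_minimum _ (violates N) (fun v => (teval v c).2)).
pose u N := sval (constructive_indefinite_description _ (minv N)).
have uP N : violates N (u N) /\
    forall w, violates N w -> (teval (u N) c).2 <= (teval w c).2.
  by rewrite /u; case: constructive_indefinite_description.
have [f [fi fR]] := ramsey_and (ramsey_trace p) (ramsey_trace c) u.
set x := u (f 0); have [[xr xp xc xlt] _] := uP (f 0); rewrite -/x in xr xp xc xlt.
have fge k : k <= f k by elim: k => // k IH; apply: leq_ltn_trans IH (fi _ _ _).
pose k := (teval x c).2.+1; have lek := fge k.
have [Rp Rc] := fR 0 k isT; set y := u (f k) in Rp Rc.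
have [[yr yp yc ylt] ymin] := uP (f k); rewrite -/y in yr yp yc ylt ymin.
have [ep lp zp] := teval_vdiff Rp; have [ec lc zc] := teval_vdiff Rc.
have zle : (teval y c).2 - (teval x c).2 <= f k * ((teval y p).2 - (teval x p).2).
  rewrite leqNgt; apply/negP => lt.
  have /ymin : violates (f k) (vdiff x y).
    by split; rewrite ?zp ?zc //; exact: in_range_vdiff.
  rewrite zc /=; move: lc (leq_ltn_trans (leq0n _) xlt).
  by move: (teval x c).2 (teval y c).2 => a b; clear; lia.
have p0 : (teval x p).2 = 0.
  apply/eqP; rewrite -leqn0 leqNgt; apply/negP => pos.
  have := leq_pmulr (f k) pos; have := leq_mul (leqnn (f k)) lp.
  move: zle lek lc ylt; rewrite mulnBr /k.
  move: (teval x c).2 (teval y c).2 (f _ * (teval x p).2) (f _ * (teval y p).2).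
  by clear; lia.
have := in_range_detachment xr; move: xp p0 xlt.
case: (teval x p) (teval x c) => [[] a] [b d] //= _ -> lt /(_ erefl) [_ e].
by move: lt; rewrite e ltn0.
Qed.

End ChangDeduction.

Record is_hoop (A : hoopAlg) : Prop := IsHoop {
  mulh1 : forall x : A, hmul x (hone A) = x;
  mul1h : forall x : A, hmul (hone A) x = x;
  imp1h : forall x : A, himp (hone A) x = x;
  imphh : forall x : A, himp x x = hone A;
  divisible : forall x y : A, hmul x (himp x y) = hmul y (himp y x) }.

Definition integral (A : hoopAlg) : Prop := forall x y : A,
  hmul x y = hone A -> x = hone A /\ y = hone A.

Lemma Luk_hoop n : is_hoop (Luk n).
Proof.
have [hm hi h1] := dL_hom n.
split=> [x|x|x|x|x y]; apply: (@dL_inj n); rewrite !(hm, hi, h1) /=;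
  move: (dL_le x); try move: (dL_le y) (dL y); move: (dL x) => a //= ; lia.
Qed.

Lemma Luk_integral n : integral (Luk n).
Proof.
have [hm hi h1] := dL_hom n.
move=> x y /(congr1 (@dL n)); rewrite hm h1 => e; split; apply: dL_inj; rewrite h1;
  move: e (dL_le x) (dL_le y); move: (dL x) (dL y) => /= a b; lia.
Qed.

Lemma Comega_hoop : is_hoop Comega.
Proof.
have [hm hi h1] := dC_hom.
split=> [x|x|x|x|x y]; apply: dC_inj; rewrite !(hm, hi, h1) /=;
  try move: (dC y); move: (dC x) => a //= ; lia.
Qed.

Lemma Comega_integral : integral Comega.
Proof.
have [hm hi h1] := dC_hom.
move=> x y /(congr1 dC); rewrite hm h1 => e; split; apply: dC_inj; rewrite h1;
  move: e; move: (dC x) (dC y) => /= a b; lia.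
Qed.

Lemma Linf1_hoop : is_hoop (Linf 1).
Proof.
have [hm hi h1] := dChang_hom.
split=> [x|x|x|x|x y]; apply: dChang_inj; rewrite !(hm, hi, h1);
  try case: (dChang y) => -[] b; case: (dChang x) => -[] a /=; congr pair; lia.
Qed.

Lemma Linf1_integral : integral (Linf 1).
Proof.
have [hm hi h1] := dChang_hom.
move=> x y /(congr1 dChang); rewrite hm h1 => e; split; apply: dChang_inj; rewrite h1;
  move: e; case: (dChang x) (dChang y) => [[] a] [[] b] [] //; try (move=> ?; congr pair; lia).
Qed.

Lemma hpow_one (A : hoopAlg) k : is_hoop A -> hpow (hone A) k = hone A.
Proof. by move=> hA; elim: k => //= k ->; rewrite mul1h. Qed.

Local Notation X := (tvar 0).
Local Notation Y := (tvar 1).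

(** Every field of [is_hoop] is an identity, hence inherited from the generators. *)
Lemma valid_hoop (K : hclass) : (forall G, K G -> is_hoop G) ->
  forall A, opH (opS (opP K)) A -> is_hoop A.
Proof.
move=> hK A hA.
have id s t : valid_in K s t -> valid_eq A s t by move=> /valid_HSP; apply.
split=> [x|x|x|x|x y].
- by apply: (id (tmul X tone) X _ (fun=> x)) => G /hK hG v; exact: mulh1.
- by apply: (id (tmul tone X) X _ (fun=> x)) => G /hK hG v; exact: mul1h.
- by apply: (id (timp tone X) X _ (fun=> x)) => G /hK hG v; exact: imp1h.
- by apply: (id (timp X X) tone _ (fun=> x)) => G /hK hG v; exact: imphh.
- apply: (id (tmul X (timp X Y)) (tmul Y (timp Y X)) _ (fun n => if n is 0 then x else y)).
  by move=> G /hK hG v; exact: divisible.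
Qed.

Lemma hoop_antisym (A : hoopAlg) (x y : A) : is_hoop A ->
  himp x y = hone A -> himp y x = hone A -> x = y.
Proof.
by move=> hA e e'; have := divisible hA x y; rewrite e e' !mulh1.
Qed.

(** The product of the equivalences of all premises, which turns a quasi-identity into the form
    treated by [detachment]. *)
Definition antecedent (l : seq (term * term)) : term :=
  foldr (fun e t => tmul (tmul (timp e.1 e.2) (timp e.2 e.1)) t) tone l.

Lemma antecedent_one (A : hoopAlg) (v : nat -> A) l : is_hoop A ->
  prems v l -> teval v (antecedent l) = hone A.
Proof.
move=> hA; elim: l => //= -[s t] l IH /= [-> /IH ->].
by rewrite !imphh // !mulh1.
Qed.

Lemma antecedent_prems (A : hoopAlg) (v : nat -> A) l : is_hoop A -> integral A ->
  teval v (antecedent l) = hone A -> prems v l.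
Proof.
move=> hA iA; elim: l => //= -[s t] l IH /= /iA [/iA [e e'] /IH ?]; split=> //.
exact: hoop_antisym e e'.
Qed.

(** One exponent serves all members of [K], so the conclusion is an identity and passes to the
    variety generated by [K]. *)
Definition uniform_deduction (K : hclass) : Prop := forall p c,
  (forall G, K G -> detachment G p c) ->
  exists N, valid_in K (timp (tpow p N) c) tone.

(** For the conclusion [s = t], uniform deduction is applied to both [s -> t] and [t -> s]. The
    resulting identities hold in [A], and when the premises hold the power on the left is 1. *)
Lemma sat_qid_HSP (K : hclass) q :
  (forall G, K G -> is_hoop G) -> (forall G, K G -> integral G) ->
  uniform_deduction K ->
  (forall G, K G -> sat_qid G q) -> forall A, opH (opS (opP K)) A -> sat_qid A q.
Proof.
case: q => l [s t] hK iK dK qK A hA v /= /(antecedent_one (valid_hoop hK hA)) e.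
have hoA := valid_hoop hK hA.
have half a b : (forall G, K G -> detachment G (antecedent l) (timp a b)) ->
    himp (teval v a) (teval v b) = hone A.
  move=> /dK [N /valid_HSP /(_ A hA v)] /=; rewrite teval_tpow e hpow_one //.
  by rewrite imp1h.
apply: hoop_antisym => //; apply: half => G KG w /antecedent_prems.
  by move=> /(_ (hK _ KG) (iK _ KG)) /(qK _ KG) /= ->; apply/imphh/hK.
by move=> /(_ (hK _ KG) (iK _ KG)) /(qK _ KG) /= ->; apply/imphh/hK.
Qed.

(* The homomorphism conditions are identities of the generators, so they also
   hold at any lift of [v] to the algebra of [Q] mapping onto [G0]. *)
Lemma sat_subalgebra_image (K Q : hclass) (G0 : hoopAlg) (tau : G0 -> term) :
  quasivariety Q -> subclass Q (opH (opS (opP K))) -> opH Q G0 ->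
  (forall G, K G -> forall v : nat -> G, is_hom (fun x => teval v (tau x))) ->
  (exists v : nat -> G0, injective (fun x => teval v (tau x))) -> Q G0.
Proof.
move=> [Sigma QE] QK [B [QB [f [fh fs]]]] hom [v vi].
have [w e] := lift_valuation v fs.
apply/QE => q Sq; apply: (@sat_qid_embed _ B (fun x => teval w (tau x))).
- have id s t : valid_in K s t -> teval w s = teval w t.
    by move=> /valid_HSP /(_ B (QK _ QB) w).
  split=> [x y|x y|].
  + by apply: (id _ (tmul (tau x) (tau y))) => G /hom hG u /=; case: (hG u).
  + by apply: (id _ (timp (tau x) (tau y))) => G /hom hG u /=; case: (hG u).
  + by apply: (id _ tone) => G /hom hG u /=; case: (hG u).
- move=> x y /(congr1 f); rewrite -!(teval_hom _ _ fh) !(eq_teval _ e); exact: vi.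
- by move/QE: QB; apply.
Qed.

Lemma hom_cancel (A B C : hoopAlg) (f : A -> B) (h : B -> C) :
  is_hom h -> injective h -> is_hom (h \o f) -> is_hom f.
Proof.
case=> hm himp h1 hi [fm fi f1].
by split=> [x y|x y|]; apply: hi; rewrite ?hm ?himp ?h1 -?fm -?fi -?f1.
Qed.

Lemma hpow_one_hom (A B : hoopAlg) (d : A -> nat) : is_hoop B ->
  is_hom (fun x => hpow (hone B) (d x)).
Proof.
by move=> hB; split=> [x y|x y|]; rewrite !hpow_one // ?mulh1 ?imphh.
Qed.

(** * Embedding the generators into their preimages *)

(* With [z = 1 - x], the exponentiated equivalence is 1 exactly when [x = 1] or
   [i z] is the length of the chain, i.e. [x] is the coatom of a copy of L_i. *)
Definition luk_generator (i N : nat) : term :=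
  let e := timp (tpow X i.-1) (tpow X N) in
  timp (tpow (tmul (timp e X) (timp X e)) N) X.

Lemma luk_generator_Ldual i N m (v : nat -> Ldual m) :
  0 < i -> 0 < m -> m <= N -> i <= N -> v 0 <= m ->
  teval v (luk_generator i N) = 0 :> nat \/
  m = i * v 0 /\ teval v (luk_generator i N) = v 0.
Proof.
move=> i0 m0 mN iN vm; rewrite /= !teval_tpow !hpow_Ldual /= !teval_tpow !hpow_Ldual /=.
move: (v 0) vm => x /= xm.
have [->|x0] := posnP x; first by left; rewrite !muln0; lia.
have -> : minn m (N * x) = m by nia.
set e := m - _.
have [ex|ex] := eqVneq e x.
  right; split; last by rewrite ex subnn addn0 minn0 muln0 minn0 subn0.
  have ei : i.-1 * x + x = i * x by rewrite addnC -mulSn prednK.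
  by move: ex; rewrite /e; lia.
left; set th := minn m (_ - _ + _).
have th0 : 0 < th by move: ex; rewrite /th; lia.
have := leq_trans mN (leq_pmulr N th0); lia.
Qed.

(** The equivalence has dual value [(N - i) * x], at least [x], so its power lies below [X]. *)
Lemma luk_generator_Cdual i N (v : nat -> Cdual) :
  0 < i < N -> teval v (luk_generator i N) = 0 :> nat.
Proof.
move=> iN; rewrite /= !teval_tpow !hpow_Cdual /= !teval_tpow !hpow_Cdual /=.
move: (v 0) => /= x.
have -> : N * x - i.-1 * x = (N - i) * x + x.
  by rewrite -mulnBl -mulSnr; congr muln; lia.
nia.
Qed.

(** For [i = 1] the term would send (0, k) to (0, (N + 1) k). Reducedness excludes this case when 1
    is in [J]. *)
Lemma luk_generator_Chang i N (v : nat -> Chang) :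
  1 < i < N -> teval v (luk_generator i N) = (true, 0).
Proof.
move=> iN; rewrite /= !teval_tpow /= !teval_tpow /=.
case: (v 0) => -[] x.
  rewrite !hpow_Chang_true; congr pair.
  have -> : N * x - i.-1 * x = (N - i) * x + x.
    by rewrite -mulnBl -mulSnr; congr muln; lia.
  nia.
(* For [i = 2] the power of exponent [i.-1] is [X] itself, not yet the least element. *)
have [->|i2] := eqVneq i 2.
  rewrite (@hpow_Chang_false _ N) /= ?subn0; last lia.
  by rewrite hpow_Chang_false //; lia.
rewrite !hpow_Chang_false /= ?hpow_Chang_false; try lia.
by rewrite ?sub0n.
Qed.

(** In L_m with [m <= N], both powers are the least element unless [X] is 1, so the value is 1; in
    C_omega it is the [N]-th power of [X]. *)
Definition cancellative_generator (N : nat) : term :=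
  timp (tpow X N) (tpow X (2 * N)).

Lemma cancellative_generator_Ldual N m (v : nat -> Ldual m) :
  m <= N -> teval v (cancellative_generator N) = 0 :> nat.
Proof.
move=> mN; rewrite /= !teval_tpow !hpow_Ldual /=; move: (v 0) => /= x.
have [->|x0] := posnP x; first by rewrite !muln0 subnn.
have := leq_trans mN (leq_pmulr N x0); lia.
Qed.

Lemma cancellative_generator_Cdual N (v : nat -> Cdual) :
  teval v (cancellative_generator N) = N * v 0 :> nat.
Proof.
by rewrite /= !teval_tpow !hpow_Cdual /=; move: (v 0) => /= x; nia.
Qed.

(* Takes only the values 0 and 1 on finite chains, while on Chang's algebra it
   sends [(0, m)] to [(0, (N + 1) m)] and the elements [(1, -m)] to 1. *)
Definition chang_generator (N : nat) : term :=
  timp (tpow (timp X (tpow X N)) N) X.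

Lemma chang_generator_Ldual N m (v : nat -> Ldual m) :
  m <= N -> v 0 <= m ->
  teval v (chang_generator N) = 0 :> nat \/ teval v (chang_generator N) = m :> nat.
Proof.
move=> mN; rewrite /= !teval_tpow !hpow_Ldual /= !teval_tpow !hpow_Ldual /=.
move: (v 0) => /= x xm.
have [->|x0] := posnP x; first by left; lia.
have -> : minn m (N * x) = m by nia.
have [->|xm'] := eqVneq x m; first by right; rewrite subnn muln0 minn0 subn0.
left; have -> : minn m (N * (m - x)) = m by nia.
by lia.
Qed.

Lemma chang_generator_Chang N (v : nat -> Chang) : 1 < N ->
  (v 0).1 = true /\ teval v (chang_generator N) = (true, 0) \/
  (v 0).1 = false /\ teval v (chang_generator N) = (false, N.+1 * (v 0).2).
Proof.
move=> N1; rewrite /= !teval_tpow /= !teval_tpow /=.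
case: (v 0) => -[] x.
  left; split=> //; rewrite !hpow_Chang_true; congr pair; nia.
right; split=> //; rewrite (hpow_Chang_false _ N1) /= subn0 hpow_Chang_true.
by rewrite mulSn addnC.
Qed.

Lemma eq_hom (A B : hoopAlg) (f g : A -> B) : f =1 g -> is_hom g -> is_hom f.
Proof. by move=> e [gm gi g1]; split=> [x y|x y|]; rewrite !e. Qed.

Lemma leq_sumn (s : seq nat) m : m \in s -> m <= sumn s.
Proof.
elim: s => //= a s IH; rewrite inE => /orP[/eqP ->|/IH le]; first exact: leq_addr.
exact: leq_trans le (leq_addl _ _).
Qed.

Lemma opH_refl (K : hclass) A : K A -> opH K A.
Proof. by move=> KA; exists A; split=> //; exists id; split=> // a; exists a. Qed.

Lemma dL_teval n (v : nat -> Luk n) t : dL (teval v t) = teval (@dL n \o v) t.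
Proof. by rewrite (teval_hom _ _ (dL_hom n)). Qed.

Lemma dL_one n (x : Luk n) : dL x = 0 :> nat -> x = hone (Luk n).
Proof. by move=> e; apply: dL_inj; case: (dL_hom n) => _ _ ->. Qed.

Lemma dC_one (x : Comega) : dC x = 0 :> nat -> x = hone Comega.
Proof. by move=> e; apply: dC_inj; case: dC_hom => _ _ ->. Qed.

Lemma dChang_one (x : Linf 1) : dChang x = (true, 0) -> x = hone (Linf 1).
Proof. by move=> e; apply: dChang_inj; case: dChang_hom => _ _ ->. Qed.

Lemma tpow_hom_one (A B : hoopAlg) (d : A -> nat) (v : nat -> B) t : is_hoop B ->
  teval v t = hone B -> is_hom (fun x : A => teval v (tpow t (d x))).
Proof.
move=> hB e; apply: eq_hom (hpow_one_hom d hB) => x.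
by rewrite teval_tpow e.
Qed.

Definition Cchang (x : Comega) : Chang := (true, dC x).

Lemma Cchang_hom : is_hom Cchang.
Proof. by case: dC_hom => hm hi h1; rewrite /Cchang; split=> [x y|x y|]; rewrite ?hm ?hi ?h1. Qed.

Lemma Cchang_inj : injective Cchang.
Proof. by move=> x y [] /dC_inj. Qed.

(** * Structurality when every element of J is 1 *)

Section Structural.

Variables (I J : seq nat) (K : bool).
Hypotheses (red : reduced I J K) (J1 : J = [::] \/ J =i [:: 1]).

Lemma mem_J j : j \in J -> j = 1.
Proof. by case: J1 => -> //; rewrite inE => /eqP. Qed.

Lemma KP_ind (P : hoopAlg -> Prop) :
  (forall i, i \in I -> P (Luk i)) -> (1 \in J -> P (Linf 1)) -> (K -> P Comega) ->
  forall G, KP I J K G -> P G.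
Proof.
move=> hL hX hC G [[i iI ->]|[[_ [j jJ ->]]|[k ->]]]; [exact: hL| |exact: hC].
by move: (jJ); rewrite (mem_J jJ); exact: hX.
Qed.

Lemma KP_hoop G : KP I J K G -> is_hoop G.
Proof.
move: G; apply: KP_ind => [i _|_|_]; [exact: Luk_hoop|exact: Linf1_hoop|].
exact: Comega_hoop.
Qed.

Lemma KP_integral G : KP I J K G -> integral G.
Proof.
move: G; apply: KP_ind => [i _|_|_]; [exact: Luk_integral|exact: Linf1_integral|].
exact: Comega_integral.
Qed.

Lemma KP_uniform_deduction : uniform_deduction (KP I J K).
Proof.
move=> p c det.
have [N1 h1] : exists N1, 1 \in J -> forall N, N1 <= N ->
    valid_eq (Linf 1) (timp (tpow p N) c) tone.
  have [j1|] := boolP (1 \in J); last by exists 0.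
  have [||N hN] := @Chang_deduction _ _ dChang_hom dChang_inj _ p c; last by exists N.
    by move=> g k; exact: dChang_surj.
  apply: det; right; left; split; last by exists 1.
  by case: red => _ _; case: J j1 => // a s _ /= ? _ _.
have [N2 h2] : exists N2, K -> forall N, N2 <= N ->
    valid_eq Comega (timp (tpow p N) c) tone.
  have [k|] := boolP K; last by exists 0.
  have [||N hN] := @Chang_deduction _ _ Cchang_hom Cchang_inj _ p c; last by exists N.
    by move=> g a; have [y e] := dC_surj a; exists y; rewrite /Cchang e.
  by apply: det; right; right.
(* [sumn I] bounds every element of [I], as [Luk_deduction] requires. *)
exists (maxn (sumn I) (maxn N1 N2)); apply: KP_ind => [i iI|j1|k].
- by apply: Luk_deduction; [apply: det; left; exists i|have := leq_sumn iI; lia].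
- by apply: h1 => //; lia.
- by apply: h2 => //; lia.
Qed.

(** Strictly above every element of [I], and at least 2 as Chang's algebra requires. *)
Let N := (sumn I).+2.

(** An element of L_i is a power of its coatom, so it is mapped to that power of [luk_generator]. In
    L_m a value other than 1 forces [i] to divide [m], hence [m = i] by reducedness, and the map is
    then the identity. *)
Lemma Luk_image (Q : hclass) i : quasivariety Q -> subclass Q (VP I J K) -> i \in I ->
  opH Q (Luk i) -> Q (Luk i).
Proof.
move=> qQ QV iI; have [[/allP Ipos _] _ _ Ired _] := red.
have i0 := Ipos _ iI; have iN : i < N by have := leq_sumn iI; rewrite /N; lia.
have pow_id (a : Luk i) : dL a = 1 :> nat -> forall x, hpow a (dL x) = x.
  move=> a1 x; apply: dL_inj; rewrite (hom_hpow _ _ (dL_hom i)) hpow_Ldual a1 muln1.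
  by apply/minn_idPr/dL_le.
move=> /(sat_subalgebra_image qQ QV (tau := fun x => tpow (luk_generator i N) (dL x))).
apply; first apply: KP_ind => [m mI v|j1 v|k v].
- have mN : m <= N by have := leq_sumn mI; rewrite /N; lia.
  have := luk_generator_Ldual i0 (Ipos _ mI) mN (ltnW iN) (dL_le (v 0) : (@dL m \o v) 0 <= m).
  rewrite -dL_teval => -[/dL_one|[em ea]]; first exact/tpow_hom_one/Luk_hoop.
  have mi : m = i.
    apply/eqP; apply: contraT => ne.
    by move: (Ired i iI m); rewrite mI ne em dvdn_mulr // => /(_ isT).
  subst m; move: em; rewrite -[LHS]muln1 => /eqP; rewrite eqn_pmul2l // => /eqP v1.
  apply: eq_hom (_ : is_hom id) => // x; rewrite teval_tpow pow_id //.
  by rewrite ea.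
- apply/tpow_hom_one; first exact: Linf1_hoop.
  apply: dChang_one; rewrite -(teval_hom _ _ dChang_hom) luk_generator_Chang // iN andbT.
  rewrite ltn_neqAle i0 andbT; apply/eqP => i1.
  by move: (Ired i iI 1); rewrite j1 orbT -i1 => /(_ isT).
- apply/tpow_hom_one; first exact: Comega_hoop.
  by apply: dC_one; rewrite -(teval_hom _ _ dC_hom) luk_generator_Cdual // iN i0.
have [a a1] := dL_surj i0.
have ea : dL (teval (fun=> a) (luk_generator i N)) = 1 :> nat.
  rewrite dL_teval.
  have a1' : (@dL i \o (fun=> a : Luk i)) 0 <= i by rewrite /= a1.
  have := luk_generator_Ldual i0 i0 (ltnW iN) (ltnW iN) a1'.
  case=> [|[_ ->]]; last by [].
  by rewrite /= !teval_tpow !hpow_Ldual /= !teval_tpow !hpow_Ldual /= a1; lia.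
by exists (fun=> a) => x y; rewrite !teval_tpow !pow_id.
Qed.

(** On C_omega the map multiplies dual values by [N * dC (v 0)]; it is trivial on the finite chains,
    and reducedness leaves no other generator. *)
Lemma Comega_image (Q : hclass) : quasivariety Q -> subclass Q (VP I J K) -> K ->
  opH Q Comega -> Q Comega.
Proof.
move=> qQ QV k.
have Jnil : 1 \in J -> False.
  by case: red => _ _; rewrite k; case: J => //= a s /implyP ->.
move=> /(sat_subalgebra_image qQ QV (tau := fun x => tpow (cancellative_generator N) (dC x))).
apply; first apply: KP_ind => [m mI v|/Jnil //|_ v].
- have mN : m <= N by have := leq_sumn mI; rewrite /N; lia.
  apply/tpow_hom_one; first exact: Luk_hoop.
  by apply: dL_one; rewrite dL_teval cancellative_generator_Ldual.
- apply: (hom_cancel dC_hom dC_inj); case: dC_hom => hm hi h1.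
  apply: (eq_hom (g := fun x => (dC x * (N * dC (v 0)))%N : Cdual)) => [x|].
    rewrite /= -(teval_hom _ _ dC_hom) teval_tpow hpow_Cdual.
    by rewrite cancellative_generator_Cdual.
  by split=> [x y|x y|]; rewrite ?hm ?hi ?h1 /= ?mulnDl ?mulnBl.
have [a a1] := dC_surj 1; exists (fun=> a) => x y /(congr1 dC).
rewrite -!(teval_hom _ _ dC_hom) !teval_tpow !hpow_Cdual.
rewrite cancellative_generator_Cdual /= a1 muln1 => /eqP; rewrite eqn_pmul2r //.
by move/eqP/dC_inj.
Qed.

(** If [t] is (0, M), then [t -> t^2] is (1, -M) and [t^2] is the least element. The two terms
    therefore describe (1, -kM) and (0, kM), with k the second component of [z]. *)
Definition chang_elem (z : bool * nat) : term :=
  let t := chang_generator N in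
  if z.1 then tpow (timp t (tpow t 2)) z.2
  else timp (tpow (timp t (tpow t 2)) z.2) (tpow t 2).

(** On a finite chain the map factors through the two-element quotient of Chang's algebra; on
    L_1^infty it is trivial or scales second coordinates, injectively at (0, 1). *)
Lemma Linf1_image (Q : hclass) : quasivariety Q -> subclass Q (VP I J K) -> 1 \in J ->
  opH Q (Linf 1) -> Q (Linf 1).
Proof.
move=> qQ QV j1; have [cm ci c1] := dChang_hom.
have Kf : K -> False.
  by case: red => _ _; case: K; case: J j1 => //.
move=> /(sat_subalgebra_image qQ QV (tau := fun x => chang_elem (dChang x))).
have elem_Chang (v : nat -> Chang) M z : teval v (chang_generator N) = (false, M) ->
    teval v (chang_elem z) = (z.1, z.2 * M).
  rewrite /chang_elem; move: (chang_generator N) => t e; case: z => -[] a /=;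
    by rewrite teval_tpow /= e /= ?subn0 hpow_Chang_true // addn0.
apply; first apply: KP_ind => [m mI v|_ v|/Kf //].
- have mN : m <= N by have := leq_sumn mI; rewrite /N; lia.
  apply: (hom_cancel (dL_hom m) (@dL_inj m)).
  have := chang_generator_Ldual mN (dL_le (v 0) : (@dL m \o v) 0 <= m).
  set s := teval _ _ => sE.
  apply: (eq_hom (g := fun x => (if (dChang x).1 then 0 else s)%N : Ldual m)) => [x|].
    rewrite [LHS]/= dL_teval /chang_elem; move: @s sE; move: (chang_generator N) => t s sE.
    by case: (dChang x) => -[] a; rewrite /= teval_tpow hpow_Ldual /= -/s; case: sE => ->; lia.
  split=> [x y|x y|]; rewrite ?cm ?ci ?c1 //;
    by case: (dChang x) (dChang y) => [[] a] [[] b] //=; case: sE => ->; lia.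
- apply: (hom_cancel dChang_hom dChang_inj).
  have [[_ e]|[_ e]] := @chang_generator_Chang N (dChang \o v) isT.
    apply: (eq_hom (g := fun _ => (true, 0) : Chang)) => [x|]; last by [].
    rewrite [LHS]/= -(teval_hom _ _ dChang_hom) /chang_elem.
    move: (chang_generator N) e => t e; case: (dChang x) => -[] a;
    by rewrite /= teval_tpow /= e /= hpow_Chang_true muln0.
  set M := _ * _ in e.
  apply: (eq_hom (g := fun x => ((dChang x).1, (dChang x).2 * M) : Chang)) => [x|].
    by rewrite [LHS]/= -(teval_hom _ _ dChang_hom); exact: elem_Chang.
  split=> [x y|x y|]; rewrite ?cm ?ci ?c1 //;
    by case: (dChang x) (dChang y) => [[] a] [[] b] //=; rewrite ?mulnDl ?mulnBl.
have [a a1] := dChang_surj (false, 1); exists (fun=> a) => x y /(congr1 dChang).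
rewrite -!(teval_hom _ _ dChang_hom).
have [[]|[_ e]] := @chang_generator_Chang N (dChang \o (fun=> a)) isT.
  by rewrite -[(_ \o _) 0]/(dChang a) a1.
rewrite !(elem_Chang _ _ _ e) -[(_ \o _) 0]/(dChang a) a1 muln1 => exy.
apply: dChang_inj; case: (dChang x) (dChang y) exy => [b k] [b' k'] [-> /eqP].
by rewrite eqn_pmul2r // => /eqP ->.
Qed.

Theorem structural_VP : structural (VP I J K).
Proof.
move=> Q qQ QV HQ A; split; first exact: QV.
have gen G : KP I J K G -> Q G.
  move=> KG; have : opH Q G by apply/HQ/opH_refl/sub_HSP.
  move: G KG; apply: KP_ind => [i iI|j1|k]; [exact: Luk_image|exact: Linf1_image|].
  exact: Comega_image.
have [Sigma QE] := qQ => VA; apply/QE => q Sq.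
apply: (sat_qid_HSP KP_hoop KP_integral KP_uniform_deduction) VA => G /gen /QE; exact.
Qed.

End Structural.

(** * The case of an element of J above 1 *)

(* The first premise makes [X] equal to 1 or to the coatom of a copy of L_n, and
   the second makes [Y] infinitesimally close to 1. *)
Definition coatom_qid (n N : nat) : quasi_id :=
  ([:: (timp (tpow X n.-1) (tpow X N), X); (timp X (tpow Y N), tone)], (Y, tone)).

Lemma hpow_Lexdual n (a b : int) k : (0 < a \/ a = 0 /\ 0 <= b)%R ->
  hpow ((a, b) : Lexdual n) k =
  gmin lexle (Posz k * a, Posz k * b)%R (Posz n, 0%R).
Proof.
move=> pos; elim: k => [|k IH]; first by rewrite /= !mul0r /gmin /lexle /=; case: n.
rewrite /hpow iterS -/(hpow _ _) IH /= !intS !mulrDl !mul1r.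
have : (0 < Posz k * a \/ a = 0 /\ Posz k * a = 0 /\ 0 <= Posz k * b \/
        Posz k * a = 0 /\ Posz k * b = 0)%R.
  have [->|k0] := posnP k; first by right; right; rewrite !mul0r.
  case: pos => [a0|[-> b0]]; first by left; rewrite mulr_gt0.
  by right; left; rewrite mulr0 mulr_ge0.
move: (Posz k * a)%R (Posz k * b)%R => ka kb pos'.
rewrite {2 3}/gmin; case: ifP => /=; rewrite /gmin; do 2?[case: ifP];
  by rewrite /lexle /=; move=> *; congr pair; lia.
Qed.

(** If [Y] is not 1, its [N]-th power is the least element, and so is [X] by the second premise. The
    left side of the first premise is then 1, whereas [X] is not. *)
Lemma sat_Luk n N i : 1 < n < N -> 0 < i < N -> sat_qid (Luk i) (coatom_qid n N).
Proof.
move=> nN iN v [/= e1 [e2 _]]; apply: dL_one; move: e1 e2.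
move=> /(congr1 (@dL i)) + /(congr1 (@dL i)).
have [hm hi h1] := dL_hom i; rewrite h1 !hi !teval_tpow !(hom_hpow _ _ (dL_hom i)) /=.
rewrite !hpow_Ldual.
move: (dL_le (v 0)) (dL_le (v 1)); move: (dL (v 0)) (dL (v 1)) => /= z w zi wi.
have [->|w0] := posnP w; first by [].
have -> : minn i (N * w) = i by have := leq_pmulr N w0; lia.
have [->|z0] := posnP z; first by lia.
have -> : minn i (N * z) = i by have := leq_pmulr N z0; lia.
have := leq_pmull z (n := n.-1); lia.
Qed.

(** If [z] is infinitesimal, the first premise forces [z = 0] because [n < N], and the second then
    gives [w = 0]. Otherwise the [N]-th power of [z] is the least element and the first premise says
    that [n] times [z] is (j, 0). *)
Lemma coatom_Lexdual n N j (z w : Lexdual j) : 1 < n < N -> 0 < j < N ->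
  lexseg j z -> lexseg j w ->
  himp (hpow z n.-1) (hpow z N) = z -> himp z (hpow w N) = (0%R, 0%R) ->
  w = (0%R, 0%R) \/ (Posz n * z.1 = Posz j)%R /\ z.2 = 0%R.
Proof.
case: z w => [a b] [c d] nN jN; rewrite /lexseg /lexle /= => hz hw.
rewrite !hpow_Lexdual /=; try lia.
have small (x : int) : gmin lexle (0, x)%R (Posz j, 0)%R = (0, x)%R.
  by rewrite /gmin /lexle /=; case: ifP => //; lia.
have big (x y : int) : (Posz j < x)%R -> gmin lexle (x, y) (Posz j, 0)%R = (Posz j, 0)%R.
  by rewrite /gmin /lexle /=; case: ifP => //; lia.
have [[a0 b0]|a0] : (a = 0 /\ 0 <= b \/ 0 < a)%R by lia.
  have fb : (Posz n.-1 * b + 2 * b <= Posz N * b)%R by nia.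
  subst a; rewrite !mulr0 !small /= => e1.
  have {e1}-> : b = 0%R.
    by move: e1; rewrite /gmax /lexle /=; case: ifP => _ [] //; lia.
  have [[c0 d0]|c0] : (c = 0 /\ 0 <= d \/ 0 < c)%R by lia.
    have fd : (d <= Posz N * d)%R by nia.
    subst c; rewrite mulr0 small /= /gmax /lexle /=.
    by case: ifP => [h _|h []]; left; congr pair; lia.
  rewrite big; last by nia.
  by rewrite /gmax /lexle /=; case: ifP => [h _|h []]; lia.
rewrite (big (Posz N * a)%R) => [e1 _|]; last by nia.
right; have an : (Posz n * a = Posz n.-1 * a + a)%R by nia.
have bn : (Posz n * b = Posz n.-1 * b + b)%R by nia.
suff [h1 h2] : (Posz n * a = Posz j /\ Posz n * b = 0)%R by split=> //; nia.
rewrite an bn; move: e1; move: (Posz n.-1 * a)%R (Posz n.-1 * b)%R => na nb.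
rewrite /gmin; case: ifP => _ /=; rewrite /gmax; case: ifP => _ []; lia.
Qed.

(** * A subalgebra of L_n^infty with the same identities *)

Fixpoint tsize (t : term) : nat :=
  match t with
  | tvar _ => 1
  | tone => 0
  | tmul s t | timp s t => tsize s + tsize t
  end.

(** First coordinates of values depend on first coordinates only. At an end of the segment the
    second coordinate is cut at 0, which commutes with scaling by [L] and is 1-Lipschitz, so errors
    just add up over the variable occurrences counted by [tsize]. *)
Lemma perturbation n (L e : nat) (v w : nat -> Lexdual n) t :
  (forall k, (v k).1 = (w k).1 /\ `|(w k).2 - Posz L * (v k).2| <= Posz e)%R ->
  ((teval v t).1 = (teval w t).1 /\
   `|(teval w t).2 - Posz L * (teval v t).2| <= Posz (e * tsize t))%R.
Proof.
have scale (x y : int) : (x <= y -> Posz L * x <= Posz L * y)%R by nia.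
move=> vw; elim: t => [k||s + t|s + t] /=; first by rewrite muln1.
- by rewrite mulr0.
- case: (teval v s) (teval v t) (teval w s) (teval w t) => [a b] [a' b'] [c d] [c' d'] /=.
  move=> [<- h] [<- h']; have := scale (b + b')%R 0%R; have := scale 0%R (b + b')%R.
  have := mulrDr (Posz L) b b'; rewrite mulnDr mulr0; move: h h'.
  rewrite /gmin /lexle /=; do 2![case: ifP => /= ?]; rewrite ?mulr0;
  move: (Posz L * b)%R (Posz L * b')%R (Posz L * (b + b'))%R (e * tsize s) (e * tsize t);
  by move=> x y z p q h h' xyz s1 s2; split; lia.
- case: (teval v s) (teval v t) (teval w s) (teval w t) => [a b] [a' b'] [c d] [c' d'] /=.
  move=> [<- h] [<- h']; have := scale (b' - b)%R 0%R; have := scale 0%R (b' - b)%R.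
  have := mulrBr (Posz L) b' b; rewrite mulnDr mulr0; move: h h'.
  rewrite /gmax /lexle /=; do 2![case: ifP => /= ?]; rewrite ?mulr0;
  move: (Posz L * b)%R (Posz L * b')%R (Posz L * (b' - b))%R (e * tsize s) (e * tsize t);
  by move=> x y z p q h h' xyz s1 s2; split; lia.
Qed.

Lemma scaled_close (p q l : nat) (b d f : int) :
  (`|f - Posz l * b| <= Posz p)%R -> (`|f - Posz l * d| <= Posz q)%R -> p + q < l -> b = d.
Proof. by move=> hb hd lt; have [?|?|//] := ltgtP b d; nia. Qed.

Section Skew.

Variable n : nat.

Definition skewed (z : int * int) : bool := (Posz n %| (z.1 - z.2)%R)%Z.

Lemma skew_mul (x y : Linf n) :
  skewed (dX x) -> skewed (dX y) -> skewed (dX (hmul x y)).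
Proof.
case: (dX_hom n) => -> _ _; case: (dX x) (dX y) => [a b] [c d].
rewrite /skewed /= => hx hy; rewrite /gmin; case: ifP => _ /=; last by rewrite subr0 dvdzz.
by rewrite opprD addrACA rpredD.
Qed.

Lemma skew_imp (x y : Linf n) :
  skewed (dX x) -> skewed (dX y) -> skewed (dX (himp x y)).
Proof.
case: (dX_hom n) => _ -> _; case: (dX x) (dX y) => [a b] [c d].
rewrite /skewed /= => hx hy; rewrite /gmax; case: ifP => _ /=; first by rewrite subrr dvdz0.
have -> : (c - a - (d - b) = (c - d) - (a - b))%R by lia.
by rewrite rpredB.
Qed.

Lemma skew_one : skewed (dX (hone (Linf n))).
Proof. by case: (dX_hom n) => _ _ ->; rewrite /skewed /= subrr dvdz0. Qed.

(* Isomorphic to L_{n,-1}: the group {(a,b) : n | b - a} has basis (1,1), (0,n),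
   and (n,0) = n(1,1) - (0,n). *)
Definition Lskew : hoopAlg := @HoopAlg {x : Linf n | skewed (dX x)}
  (fun x y => exist (fun x => skewed (dX x)) _ (skew_mul (svalP x) (svalP y)))
  (fun x y => exist (fun x => skewed (dX x)) _ (skew_imp (svalP x) (svalP y)))
  (exist (fun x => skewed (dX x)) _ skew_one).

Lemma sval_skew_hom : @is_hom Lskew (Linf n) sval.
Proof. by []. Qed.

Lemma sval_skew_inj : injective (sval : Lskew -> Linf n).
Proof. exact: val_inj. Qed.

(* Replacing each second coordinate [b] by [L b + off a], for [L] a large multiple
   of [n], moves a valuation into [Lskew n] without identifying distinct values. *)
Lemma valid_Lskew s t : 0 < n -> valid_eq Lskew s t -> valid_eq (Linf n) s t.
Proof.
move=> n0 h v; apply: dX_inj; rewrite -!(teval_hom _ _ (dX_hom n)).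
(* Divisible by [n], and larger than the sum of the error bounds for [s] and [t]. *)
pose L := n * (n * (tsize s + tsize t)).+1.
(* At [a = n] the second coordinate must stay nonpositive, so the offset is 0, which is congruent to
   [a] modulo [n] there too. *)
pose off (a : int) : int := if a == Posz n then 0%R else a.
have ex k : exists x : Lskew, dX (sval x) =
    ((dX (v k)).1, Posz L * (dX (v k)).2 + off (dX (v k)).1)%R.
  have [x hx] : exists x : Linf n, dX x =
      ((dX (v k)).1, Posz L * (dX (v k)).2 + off (dX (v k)).1)%R.
    apply: dX_surj; move: (dX_seg (v k)); case: (dX (v k)) => a b.
    have : (0 <= b -> 0 <= Posz L * b)%R /\ (b <= 0 -> Posz L * b <= 0)%R by split; nia.
    move: (Posz L * b)%R => lb.
    rewrite /lexseg /lexle /off /=; case: (eqVneq a (Posz n)) => /= [->|ne] sgn seg; lia.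
  suff sx : skewed (dX x) by exists (exist (fun x => skewed (dX x)) _ sx).
  rewrite hx; move: (dX (v k)) => [a b]; rewrite /skewed /off /=.
  case: (eqVneq a (Posz n)) => [->|_].
    by rewrite addr0 rpredB ?dvdzz // /L PoszM -mulrA dvdz_mulr.
  by rewrite opprD addrCA subrr addr0 rpredN /L PoszM -mulrA dvdz_mulr.
pose w k := sval (constructive_indefinite_description _ (ex k)).
have wE k : dX (sval (w k)) =
    ((dX (v k)).1, Posz L * (dX (v k)).2 + off (dX (v k)).1)%R.
  by rewrite /w; case: constructive_indefinite_description.
have close k : ((dX (v k)).1 = (dX (sval (w k))).1 /\
    `|(dX (sval (w k))).2 - Posz L * (dX (v k)).2| <= Posz n)%R.
  rewrite wE; move: (dX (v k)) (dX_seg (v k)) => [a b].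
  rewrite /lexseg /lexle /off /= => seg; split=> //; rewrite addrAC subrr add0r.
  by move: seg; case: (eqVneq a (Posz n)); lia.
have [s1 s2] := perturbation s close; have [t1 t2] := perturbation t close.
have e : teval (fun k => dX (sval (w k))) s = teval (fun k => dX (sval (w k))) t.
  have := congr1 (fun x => dX (sval x)) (h w).
  by rewrite -!(teval_hom _ _ sval_skew_hom) -!(teval_hom _ _ (dX_hom n)).
rewrite e in s1 s2.
move: (teval _ s) (teval _ t) (teval _ t) s1 s2 t1 t2 {e} => [a b] [c d] [f g] /=.
move=> -> s2 -> t2; congr pair.
by apply: scaled_close s2 t2 _; rewrite /L; nia.
Qed.

End Skew.

Lemma opH_mono (K K' : hclass) : subclass K K' -> subclass (opH K) (opH K').
Proof. by move=> sub A [B [/sub KB f]]; exists B. Qed.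

Lemma HSP_mono (K K' : hclass) : subclass K K' ->
  subclass (opH (opS (opP K))) (opH (opS (opP K'))).
Proof.
move=> sub; apply: opH_mono => A [B [[T [F [KF f]]] g]].
by exists B; split=> //; exists T, F; split=> // i; apply: sub.
Qed.

Lemma coatom_premises n N j (v : nat -> Linf j) : 1 < n < N -> 0 < j < N ->
  prems v (coatom_qid n N).1 ->
  v 1 = hone (Linf j) \/
  (Posz n * (dX (v 0)).1 = Posz j)%R /\ (dX (v 0)).2 = 0%R.
Proof.
have [hm hi h1] := dX_hom j; move=> nN jN [/= e1 [e2 _]].
have := @coatom_Lexdual n N j (dX (v 0)) (dX (v 1)) nN jN (dX_seg _) (dX_seg _).
rewrite -!(hom_hpow _ _ (dX_hom j)) -!hi.
move: e1 e2; rewrite !teval_tpow /= => -> ->; rewrite h1 => /(_ erefl erefl) [e|]; last by right.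
by left; apply: dX_inj; rewrite e h1.
Qed.

Lemma sat_Linf n N j : 1 < n < N -> 0 < j < N -> ~~ (n %| j) ->
  sat_qid (Linf j) (coatom_qid n N).
Proof.
move=> nN jN nj v /(coatom_premises nN jN) [//|[e _]].
case/negP: nj; move: e; case: (dX (v 0)).1 => a e; last by nia.
by apply/dvdnP; exists a; nia.
Qed.

(** The only value of [X] allowing [Y] to differ from 1 is (1, 0), which is not skewed as
    [n > 1]. *)
Lemma sat_Lskew n N : 1 < n < N -> sat_qid (Lskew n) (coatom_qid n N).
Proof.
move=> nN v pv; have nN' : 0 < n < N by lia.
have := coatom_premises nN nN' (prems_hom (@sval_skew_hom n) pv).
case=> [e|[e1 e2]]; first exact: val_inj.
move: (dX (sval (v 0))) (svalP (v 0)) e1 e2 => [a b]; rewrite /skewed => /= sk ea eb; move: sk; rewrite eb.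
have -> : a = 1%R by nia.
by rewrite subr0 dvdz1; lia.
Qed.

Lemma not_sat_Linf n N : 1 < n < N -> ~ sat_qid (Linf n) (coatom_qid n N).
Proof.
move=> nN; have nN' : 0 < n by lia.
have [x ex] : exists x : Linf n, dX x = (1, 0)%R.
  by apply: dX_surj; rewrite /lexseg /lexle /=; lia.
have [y ey] : exists y : Linf n, dX y = (0, 1)%R.
  by apply: dX_surj; rewrite /lexseg /lexle /=; lia.
have [hm hi h1] := dX_hom n.
move/(_ (fun k => if k is 0 then x else y)) => /= q.
suff /(congr1 (@dX n)) : y = hone (Linf n) by rewrite ey h1.
apply: q; rewrite !teval_tpow; split; [|split=> //]; apply: dX_inj;
  rewrite ?h1 !hi !(hom_hpow _ _ (dX_hom n)) ex ?ey !hpow_Lexdual //=; try lia.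
- rewrite /gmin /gmax /lexle /= !mulr0 !mulr1.
  do ![case: ifP => /=]; move=> *; congr pair; lia.
- rewrite /gmin /gmax /lexle /= !mulr0 !mulr1.
  do ![case: ifP => /=]; move=> *; congr pair; lia.
Qed.

(** * Failure of structurality when J has an element above 1 *)

Section NotStructural.

Variables (I J : seq nat) (K : bool) (n : nat).
Hypotheses (red : reduced I J K) (nJ : n \in J) (n1 : 1 < n).

Let N := (sumn I + sumn J).+1.

(** Indexes the generators as a family, the form that [birkhoff] takes. *)
Let IJ := ({i | i \in I} + {j | j \in J})%type.

Definition gen (c : IJ) : hoopAlg :=
  match c with inl i => Luk (sval i) | inr j => Linf (sval j) end.

Definition skew_gen (c : IJ) : hoopAlg :=
  match c with
  | inl i => Luk (sval i)
  | inr j => if sval j == n then Lskew n else Linf (sval j)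
  end.

Lemma K_false : K = false.
Proof. by case: red => _ _; case: K => //; case: J nJ => //= ? ? _ /implyP/(_ isT). Qed.

Lemma KP_gen A : KP I J K A <-> exists c, A = gen c.
Proof.
rewrite /KP K_false; split.
  case=> [[i hi ->]|[[_ [j hj ->]]|[]]] //.
    by exists (inl (exist _ i hi)).
  by exists (inr (exist _ j hj)).
by case=> -[[i hi]|[j hj]] ->; [left; exists i|right; left; split=> //; exists j].
Qed.

Lemma VP_of_valid A :
  (forall s t, valid_in (KP I J K) s t -> valid_eq A s t) -> VP I J K A.
Proof.
move=> h; have : opH (opS (opP (fun B => exists c, B = gen c))) A.
  by apply: birkhoff => s t hst; apply: h => G /KP_gen [c ->].
by apply: HSP_mono => B /KP_gen.
Qed.

Lemma nN : 1 < n < N.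
Proof. by have := leq_sumn nJ; rewrite /N; lia. Qed.

Lemma skew_gen_sat c : sat_qid (skew_gen c) (coatom_qid n N).
Proof.
have [[/allP Ipos /allP Jpos] _ _ _ Jred] := red.
case: c => [[i iI]|[j jJ]] /=.
  by apply: sat_Luk; [exact: nN|have := leq_sumn iI; have := Ipos _ iI; rewrite /N; lia].
case: eqVneq => [_|ne]; first exact/sat_Lskew/nN.
apply: sat_Linf; first exact: nN.
  by have := leq_sumn jJ; have := Jpos _ jJ; rewrite /N; lia.
by apply: Jred => //; rewrite jJ.
Qed.

Lemma skew_gen_valid c s t : valid_eq (skew_gen c) s t -> valid_eq (gen c) s t.
Proof.
case: c => [//|[j jJ]] /=; case: eqVneq => [->|//].
by apply: valid_Lskew; lia.
Qed.

Lemma valid_skew_gen c s t : valid_eq (gen c) s t -> valid_eq (skew_gen c) s t.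
Proof.
case: c => [//|[j jJ]] /=; case: eqVneq => [->|//] h v.
have q : sat_qid (Linf n) ([::], (s, t)) by move=> w _; exact: h.
exact: (sat_qid_embed (@sval_skew_hom n) (@sval_skew_inj n) q).
Qed.

Theorem not_structural_VP : ~ structural (VP I J K).
Proof.
(* V(P) enters through its identities, which makes [Q] visibly a quasivariety. *)
pose Q A := (forall s t, valid_in (KP I J K) s t -> valid_eq A s t) /\
  sat_qid A (coatom_qid n N).
have qQ : quasivariety Q.
  exists (fun q => q = coatom_qid n N \/
    exists s t, q = ([::], (s, t)) /\ valid_in (KP I J K) s t) => A; split.
    by case=> hA hq q [->|[s [t [-> /hA h]]]] // v _; exact: h.
  move=> h; split=> [s t st v|]; last by apply: h; left.
  by apply: (h ([::], (s, t))) => //; right; exists s, t.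
have QV : subclass Q (VP I J K) by move=> A [/VP_of_valid].
have HQ : same_class (opH Q) (opH (VP I J K)).
  move=> A; split; first exact: opH_mono QV A.
  (* The skewed generators have the same identities, so by Birkhoff's theorem [A] is an image of a
     subalgebra of a product of them, which satisfies the quasi-identity. *)
  move=> /opH_opH VA; have : opH (opS (opP (fun B => exists c, B = skew_gen c))) A.
    apply: birkhoff => s t st; apply: valid_HSP VA => G /KP_gen [c ->].
    exact: skew_gen_valid.
  apply: opH_mono => B hB; split=> [s t st v|].
    have q G : (exists c, G = skew_gen c) -> sat_qid G ([::], (s, t)).
      move=> [c ->] w _; apply: valid_skew_gen; apply: st; apply/KP_gen; by exists c.
    exact: (sat_qid_opSP q hB).
  by apply: sat_qid_opSP hB => G [c ->]; exact: skew_gen_sat.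
move/(_ Q qQ QV HQ (Linf n)) => [_ VQ].
have [] := VQ; last by move=> _ /not_sat_Linf; apply; exact: nN.
apply: sub_HSP; right; left; rewrite K_false; split=> //; by exists n.
Qed.

End NotStructural.

(** A list may repeat its elements, so [J = {1}] is expressed by equality of members. *)
Theorem theorem4p6 (I J : seq nat) (K : bool) :
  reduced I J K ->
  (structural (VP I J K) <-> (J = [::] \/ J =i [:: 1%N])).
Proof.
move=> red; split; last exact: structural_VP.
move=> st; have [all1|/allPn[n nJ n1]] := boolP (all (pred1 1) J); last first.
  case: (not_structural_VP red nJ _ st).
  by have [[_ /allP /(_ _ nJ)]] := red; move: n1 => /=; lia.
case: J all1 {red st} => [|j s]; first by left.
move=> /all_pred1P ->; right=> x; rewrite /= inE mem_nseq inE.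
by case: (x == 1); rewrite ?andbF.
Qed.
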